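(* Let $\mathcal{E}$ be a category, let $\mathcal{C}$ be a category with all colimits of shape $\mathcal{E}$, and let $\mathcal{L}\colon\mathcal{C}^{op}\to\mathbf{CAT}$ be an indexed category that is $\mathcal{E}$-extensive or, more generally, left Kan $\mathcal{E}$-extensive. Then the Grothendieck construction $\Sigma_{\mathcal{C}}\mathcal{L}$ admits fibred colimits of shape $\mathcal{E}$, that is, colimits of shape $\mathcal{E}$ that are preserved by the projection $\pi_1\colon\Sigma_{\mathcal{C}}\mathcal{L}\to\mathcal{C}$.
   Context: An indexed category is a pseudofunctor $\mathcal{L}\colon\mathcal{C}^{op}\to\mathbf{CAT}$. Its Grothendieck construction $\Sigma_{\mathcal{C}}\mathcal{L}$ has objects pairs $(A,X)$ with $A\in\mathcal{C}$, $X\in\mathcal{L}(A)$; morphisms $(A,X)\to(B,Y)$ are pairs $(f,f')$ with $f\colon A\to B$ and $f'\colon X\to\mathcal{L}(f)(Y)$ in $\mathcal{L}(A)$; composition of $(f,f')$ and $(g,g')$ is $(g\circ f,\ \mu\circ\mathcal{L}(f)(g')\circ f')$ with $\mu\colon\mathcal{L}(f)\mathcal{L}(g)\cong\mathcal{L}(g\circ f)$ the compositor. For an indexed category $\mathcal{M}\colon\mathcal{E}^{op}\to\mathbf{CAT}$, the category of sections $\Pi_{\mathcal{E}}\mathcal{M}$ has as objects families $(X_E\in\mathcal{M}(E))_{E\in\mathcal{E}}$ with morphisms $\xi_e\colon X_E\to\mathcal{M}(e)(X_{E'})$ for each $e\colon E\to E'$, such that $\xi_{\mathrm{id}_E}$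 is the unitor at $X_E$ and $\xi_{e'\circ e}$ equals $\mathcal{M}(e)(\xi_{e'})\circ\xi_e$ followed by the compositor; morphisms $(X,\xi)\to(Y,\zeta)$ are families $\alpha_E\colon X_E\to Y_E$ with $\mathcal{M}(e)(\alpha_{E'})\circ\xi_e=\zeta_e\circ\alpha_E$. Let $\mathcal{C}$ admit all colimits of shape $\mathcal{E}$. $\mathcal{L}$ is $\mathcal{E}$-extensive if, for every diagram $J_1\colon\mathcal{E}\to\mathcal{C}$ with colimit $(L,\lambda\colon J_1\Rightarrow\Delta_L)$, the canonical comparison functor $\mathcal{L}(\lambda)\colon\mathcal{L}(L)\to\Pi_{\mathcal{E}}(\mathcal{L}\circ J_1^{op})$, $Z\mapsto(E\mapsto\mathcal{L}(\lambda_E)(Z))$ (with structure maps the inverse compositors), is an equivalence. It is left Kan $\mathcal{E}$-extensive if each of these comparison functors merely admits a left adjoint. *)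

(* Defs.v *)
From Stdlib Require Import ssreflect.
From Stdlib Require Import FunctionalExtensionality ProofIrrelevance.

Set Implicit Arguments.
Unset Strict Implicit.
Unset Printing Implicit Defensive.

Declare Scope cat_scope.
Delimit Scope cat_scope with cat.
Open Scope cat_scope.

Record Category := {
  ob :> Type;
  hom : ob -> ob -> Type;
  idc : forall x, hom x x;
  comp : forall x y z, hom y z -> hom x y -> hom x z;
  comp_idl : forall x y (f : hom x y), comp (idc y) f = f;
  comp_idr : forall x y (f : hom x y), comp f (idc x) = f;
  comp_assoc : forall w x y z (f : hom w x) (g : hom x y) (h : hom y z),
    comp h (comp g f) = comp (comp h g) f }.

Arguments hom {c} x y.
Arguments idc {c} x.
Arguments comp {c x y z} g f.
Arguments comp_idl {c x y} f.
Arguments comp_idr {c x y} f.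
Arguments comp_assoc {c w x y z} f g h.

Notation "g ∘ f" := (comp g f) (at level 40, left associativity) : cat_scope.

Lemma reassoc (C : Category) (w x y z : C) (f : hom x y) (g : hom y z)
    (k : hom x z) :
  g ∘ f = k -> forall u : hom w x, g ∘ (f ∘ u) = k ∘ u.
Proof. by move=> <- u; rewrite comp_assoc. Qed.

Record Functor (C D : Category) := {
  fob :> C -> D;
  fmap : forall x y : C, hom x y -> hom (fob x) (fob y);
  fmap_id : forall x : C, fmap (idc x) = idc (fob x);
  fmap_comp : forall (x y z : C) (f : hom x y) (g : hom y z),
    fmap (g ∘ f) = fmap g ∘ fmap f }.

Arguments fmap {C D} F {x y} _ : rename.
Arguments fmap_id {C D} F x : rename.
Arguments fmap_comp {C D} F {x y z} f g : rename.

Definition Fid (C : Category) : Functor C C :=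
  @Build_Functor C C (fun x => x) (fun _ _ f => f)
    (fun _ => eq_refl) (fun _ _ _ _ _ => eq_refl).

Lemma Fcomp_id (A B C : Category) (G : Functor B C) (F : Functor A B) (x : A) :
  fmap G (fmap F (idc x)) = idc (G (F x)).
Proof. by rewrite !fmap_id. Qed.

Lemma Fcomp_comp (A B C : Category) (G : Functor B C) (F : Functor A B)
    (x y z : A) (f : hom x y) (g : hom y z) :
  fmap G (fmap F (g ∘ f)) = fmap G (fmap F g) ∘ fmap G (fmap F f).
Proof. by rewrite !fmap_comp. Qed.

Definition Fcomp (A B C : Category) (G : Functor B C) (F : Functor A B) :
    Functor A C :=
  @Build_Functor A C (fun x => G (F x)) (fun _ _ f => fmap G (fmap F f))
    (@Fcomp_id A B C G F) (@Fcomp_comp A B C G F).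

Record NatTrans (C D : Category) (F G : Functor C D) := {
  nt :> forall x : C, hom (F x) (G x);
  nt_natural : forall (x y : C) (f : hom x y),
    nt y ∘ fmap F f = fmap G f ∘ nt x }.

Record NatIso (C D : Category) (F G : Functor C D) := {
  iso_nt :> NatTrans F G;
  iso_inv : forall x : C, hom (G x) (F x);
  iso_invl : forall x, iso_inv x ∘ iso_nt x = idc (F x);
  iso_invr : forall x, iso_nt x ∘ iso_inv x = idc (G x) }.

Definition is_equivalence (C D : Category) (F : Functor C D) : Prop :=
  exists G : Functor D C,
    inhabited (NatIso (Fid C) (Fcomp G F)) /\
    inhabited (NatIso (Fcomp F G) (Fid D)).

Record Adjunction (C D : Category) (F : Functor D C) (R : Functor C D) := {
  adj_unit : NatTrans (Fid D) (Fcomp R F);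
  adj_counit : NatTrans (Fcomp F R) (Fid C);
  adj_trianglel : forall d : D,
    adj_counit (F d) ∘ fmap F (adj_unit d) = idc (F d);
  adj_triangler : forall c : C,
    fmap R (adj_counit c) ∘ adj_unit (R c) = idc (R c) }.

Definition has_left_adjoint (C D : Category) (R : Functor C D) : Prop :=
  exists F : Functor D C, inhabited (Adjunction F R).

Record Cocone (E C : Category) (J : Functor E C) := {
  apex : C;
  leg : forall e : E, hom (J e) apex;
  leg_natural : forall (e e' : E) (u : hom e e'), leg e' ∘ fmap J u = leg e }.

Definition is_colimit (E C : Category) (J : Functor E C) (c : Cocone J) : Prop :=
  forall c' : Cocone J,
    exists! h : hom (apex c) (apex c'), forall e, h ∘ leg c e = leg c' e.

Definition has_colimits (E C : Category) : Prop :=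
  forall J : Functor E C, exists c : Cocone J, is_colimit c.

Lemma map_cocone_natural (E C D : Category) (P : Functor C D) (J : Functor E C)
    (c : Cocone J) (e e' : E) (u : hom e e') :
  fmap P (leg c e') ∘ fmap (Fcomp P J) u = fmap P (leg c e).
Proof. cbn. by rewrite -fmap_comp leg_natural. Qed.

Definition map_cocone (E C D : Category) (P : Functor C D) (J : Functor E C)
    (c : Cocone J) : Cocone (Fcomp P J) :=
  @Build_Cocone E D (Fcomp P J) (P (apex c)) (fun e => fmap P (leg c e))
    (@map_cocone_natural E C D P J c).

Definition preserves_colimits (E C D : Category) (P : Functor C D) : Prop :=
  forall (J : Functor E C) (c : Cocone J),
    is_colimit c -> is_colimit (map_cocone P c).

(** The canonical 2-cell between the reindexing functors of equal morphisms. *)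
Definition transp (C : Category) (fib : C -> Category)
    (reind : forall A B : C, hom A B -> Functor (fib B) (fib A))
    (A B : C) (f g : hom A B) (p : f = g) (Z : fib B) :
    hom (reind A B f Z) (reind A B g Z) :=
  match p in _ = k return hom (reind A B f Z) (reind A B k Z) with
  | eq_refl => idc (reind A B f Z)
  end.

(** A pseudofunctor [C^op -> CAT]. The base has only identity 2-cells, but
    associativity and unitality of [C] hold propositionally, so the coherence
    axioms contain the induced 2-cells [transp]. *)
Record IndexedCat (C : Category) := {
  fib :> C -> Category;
  reind : forall A B : C, hom A B -> Functor (fib B) (fib A);
  unitor : forall A : C, NatIso (Fid (fib A)) (reind (idc A));
  compositor : forall (A B D : C) (f : hom A B) (g : hom B D),
    NatIso (Fcomp (reind f) (reind g)) (reind (g ∘ f));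
  unitor_l : forall (A B : C) (f : hom A B) (Z : fib B),
    compositor (idc A) f Z ∘ unitor A (reind f Z)
    = transp reind (eq_sym (comp_idr f)) Z;
  unitor_r : forall (A B : C) (f : hom A B) (Z : fib B),
    compositor f (idc B) Z ∘ fmap (reind f) (unitor B Z)
    = transp reind (eq_sym (comp_idl f)) Z;
  compositor_assoc : forall (A B D K : C) (f : hom A B) (g : hom B D)
      (h : hom D K) (Z : fib K),
    compositor f (h ∘ g) Z ∘ fmap (reind f) (compositor g h Z)
    = transp reind (comp_assoc f g h) Z
      ∘ (compositor (g ∘ f) h Z ∘ compositor f g (reind h Z)) }.

Arguments reind {C} i {A B} _.
Arguments unitor {C} i A.
Arguments compositor {C} i {A B D} f g.
Arguments unitor_l {C} i {A B} f Z.
Arguments unitor_r {C} i {A B} f Z.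
Arguments compositor_assoc {C} i {A B D K} f g h Z.

Section Coherence.
Variables (C : Category) (L : IndexedCat C).

Definition ctr (A B : C) (f g : hom A B) (p : f = g) (Z : L B) :
  hom (reind L f Z) (reind L g Z) := transp (@reind C L) p Z.

(** The structure 2-cells, retyped with composite and identity functors
    unfolded. *)
Definition mu (A B D : C) (f : hom A B) (g : hom B D) (Z : L D) :
  hom (reind L f (reind L g Z)) (reind L (g ∘ f) Z) := compositor L f g Z.

Definition mu_inv (A B D : C) (f : hom A B) (g : hom B D) (Z : L D) :
  hom (reind L (g ∘ f) Z) (reind L f (reind L g Z)) :=
  iso_inv (compositor L f g) Z.

Definition eta (A : C) (Z : L A) : hom Z (reind L (idc A) Z) := unitor L A Z.

Definition eta_inv (A : C) (Z : L A) : hom (reind L (idc A) Z) Z :=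
  iso_inv (unitor L A) Z.

Lemma ctr_id (A B : C) (f : hom A B) (p : f = f) Z : ctr p Z = idc _.
Proof. by rewrite (proof_irrelevance _ p eq_refl). Qed.

Lemma ctr_irr (A B : C) (f g : hom A B) (p q : f = g) Z : ctr p Z = ctr q Z.
Proof. by rewrite (proof_irrelevance _ p q). Qed.

Lemma ctr_trans (A B : C) (f g h : hom A B) (p : f = g) (q : g = h) Z :
  ctr q Z ∘ ctr p Z = ctr (eq_trans p q) Z.
Proof. destruct q. unfold ctr at 1. cbn. by rewrite comp_idl. Qed.

Lemma ctr_nat (A B : C) (f g : hom A B) (p : f = g) (Z W : L B) (m : hom Z W) :
  ctr p W ∘ fmap (reind L f) m = fmap (reind L g) m ∘ ctr p Z.
Proof. destruct p. unfold ctr. cbn. by rewrite comp_idl comp_idr. Qed.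

Lemma mu_nat (A B D : C) (f : hom A B) (g : hom B D) (Z W : L D) (m : hom Z W) :
  mu f g W ∘ fmap (reind L f) (fmap (reind L g) m)
  = fmap (reind L (g ∘ f)) m ∘ mu f g Z.
Proof. exact (nt_natural (compositor L f g) m). Qed.

Lemma eta_nat (A : C) (Z W : L A) (m : hom Z W) :
  eta W ∘ m = fmap (reind L (idc A)) m ∘ eta Z.
Proof. exact (nt_natural (unitor L A) m). Qed.

Lemma mu_invK (A B D : C) (f : hom A B) (g : hom B D) (Z : L D) :
  mu_inv f g Z ∘ mu f g Z = idc _.
Proof. exact (iso_invl (compositor L f g) Z). Qed.

Lemma mu_Kinv (A B D : C) (f : hom A B) (g : hom B D) (Z : L D) :
  mu f g Z ∘ mu_inv f g Z = idc _.
Proof. exact (iso_invr (compositor L f g) Z). Qed.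

Lemma eta_invK (A : C) (Z : L A) : eta_inv Z ∘ eta Z = idc _.
Proof. exact (iso_invl (unitor L A) Z). Qed.

Lemma eta_Kinv (A : C) (Z : L A) : eta Z ∘ eta_inv Z = idc _.
Proof. exact (iso_invr (unitor L A) Z). Qed.

Lemma mu_etal (A B : C) (f : hom A B) (Z : L B) :
  mu (idc A) f Z ∘ eta (reind L f Z) = ctr (eq_sym (comp_idr f)) Z.
Proof. exact (unitor_l L f Z). Qed.

Lemma mu_etar (A B : C) (f : hom A B) (Z : L B) :
  mu f (idc B) Z ∘ fmap (reind L f) (eta Z) = ctr (eq_sym (comp_idl f)) Z.
Proof. exact (unitor_r L f Z). Qed.

Lemma mu_assoc (A B D K : C) (f : hom A B) (g : hom B D) (h : hom D K) (Z : L K) :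
  mu f (h ∘ g) Z ∘ fmap (reind L f) (mu g h Z)
  = ctr (comp_assoc f g h) Z ∘ (mu (g ∘ f) h Z ∘ mu f g (reind L h Z)).
Proof. exact (compositor_assoc L f g h Z). Qed.

Lemma mu_ctrl (A B D : C) (f f' : hom A B) (p : f = f') (g : hom B D) (Z : L D) :
  mu f' g Z ∘ ctr p (reind L g Z) = ctr (f_equal (comp g) p) Z ∘ mu f g Z.
Proof. destruct p. rewrite !ctr_id. by rewrite comp_idl comp_idr. Qed.

Lemma mu_ctrr (A B D : C) (f : hom A B) (g g' : hom B D) (p : g = g') (Z : L D) :
  mu f g' Z ∘ fmap (reind L f) (ctr p Z)
  = ctr (f_equal (fun k => k ∘ f) p) Z ∘ mu f g Z.
Proof.
destruct p. rewrite !ctr_id fmap_id. by rewrite comp_idl comp_idr.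
Qed.

Lemma mu_assoc_inv (A B D K : C) (f : hom A B) (g : hom B D) (h : hom D K)
    (Z : L K) :
  mu (g ∘ f) h Z ∘ mu f g (reind L h Z)
  = ctr (eq_sym (comp_assoc f g h)) Z
    ∘ (mu f (h ∘ g) Z ∘ fmap (reind L f) (mu g h Z)).
Proof. by rewrite mu_assoc (reassoc (ctr_trans _ _ Z)) ctr_id comp_idl. Qed.

Lemma mu_mono (A B D : C) (f : hom A B) (g : hom B D) (Z : L D) (X : L A)
    (u v : hom X (reind L f (reind L g Z))) :
  mu f g Z ∘ u = mu f g Z ∘ v -> u = v.
Proof.
intros H. rewrite -(comp_idl u) -(comp_idl v) -(mu_invK f g Z).
by rewrite -!comp_assoc H.
Qed.

End Coherence.

Section Grothendieck.
Variables (C : Category) (L : IndexedCat C).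

Record GrothOb := { gbase : C; gfib : L gbase }.

Record GrothHom (X Y : GrothOb) := {
  hbase : hom (gbase X) (gbase Y);
  hfib : hom (gfib X) (reind L hbase (gfib Y)) }.

Lemma GrothHom_eq (X Y : GrothOb) (u v : GrothHom X Y)
    (p : hbase u = hbase v) :
  ctr p (gfib Y) ∘ hfib u = hfib v -> u = v.
Proof.
destruct u as [f f'], v as [g g']. cbn in *. destruct p.
rewrite ctr_id comp_idl. now intros ->.
Qed.

Definition groth_id (X : GrothOb) : GrothHom X X :=
  {| hbase := idc (gbase X); hfib := unitor L (gbase X) (gfib X) |}.

Definition groth_comp (X Y Z : GrothOb) (v : GrothHom Y Z) (u : GrothHom X Y) :
    GrothHom X Z :=
  {| hbase := hbase v ∘ hbase u;
     hfib := compositor L (hbase u) (hbase v) (gfib Z)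
             ∘ (fmap (reind L (hbase u)) (hfib v) ∘ hfib u) |}.

Lemma groth_idl X Y (u : GrothHom X Y) : groth_comp (groth_id Y) u = u.
Proof.
apply (@GrothHom_eq X Y (groth_comp (groth_id Y) u) u (comp_idl (hbase u))). cbn.
fold (mu (hbase u) (idc (gbase Y)) (gfib Y)). fold (eta (gfib Y)).
rewrite (comp_assoc (hfib u)) mu_etar comp_assoc ctr_trans ctr_id.
apply comp_idl.
Qed.

Lemma groth_idr X Y (u : GrothHom X Y) : groth_comp u (groth_id X) = u.
Proof.
apply (@GrothHom_eq X Y (groth_comp u (groth_id X)) u (comp_idr (hbase u))). cbn.
fold (mu (idc (gbase X)) (hbase u) (gfib Y)). fold (eta (gfib X)).
rewrite -eta_nat (comp_assoc (hfib u)) mu_etal comp_assoc ctr_trans ctr_id.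
apply comp_idl.
Qed.

Lemma groth_assoc W X Y Z (u : GrothHom W X) (v : GrothHom X Y)
    (w : GrothHom Y Z) :
  groth_comp w (groth_comp v u) = groth_comp (groth_comp w v) u.
Proof.
apply: (@GrothHom_eq W Z (groth_comp w (groth_comp v u))
  (groth_comp (groth_comp w v) u) (comp_assoc (hbase u) (hbase v) (hbase w))).
case: u v w => [f f'] [g g'] [h h'] /=.
rewrite -/(mu (g ∘ f) h (gfib Z)) -/(mu f g (gfib Y)) -/(mu f (h ∘ g) (gfib Z)).
rewrite -/(mu g h (gfib Z)) !fmap_comp -!(@comp_assoc (L (gbase W))).
rewrite (reassoc (mu_assoc f g h (gfib Z))) -!(@comp_assoc (L (gbase W))).
by rewrite (reassoc (mu_nat f g h')) -!(@comp_assoc (L (gbase W))).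
Qed.

Definition Groth : Category :=
  {| ob := GrothOb; hom := GrothHom; idc := groth_id; comp := groth_comp;
     comp_idl := groth_idl; comp_idr := groth_idr; comp_assoc := groth_assoc |}.

Definition groth_proj : Functor Groth C :=
  @Build_Functor Groth C gbase hbase (fun _ => eq_refl)
    (fun _ _ _ _ _ => eq_refl).

End Grothendieck.

Section Sections.
Variables (E : Category) (M : IndexedCat E).

Record SecOb := {
  sec :> forall e : E, M e;
  sec_map : forall (e e' : E) (u : hom e e'), hom (sec e) (reind M u (sec e'));
  sec_id : forall e : E, sec_map (idc e) = unitor M e (sec e);
  sec_comp : forall (e e' e'' : E) (u : hom e e') (v : hom e' e''),
    sec_map (v ∘ u)
    = compositor M u v (sec e'') ∘ (fmap (reind M u) (sec_map v) ∘ sec_map u) }.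

Record SecHom (X Y : SecOb) := {
  sec_hom :> forall e : E, hom (X e) (Y e);
  sec_hom_natural : forall (e e' : E) (u : hom e e'),
    fmap (reind M u) (sec_hom e') ∘ sec_map X u = sec_map Y u ∘ sec_hom e }.

Lemma SecHom_eq (X Y : SecOb) (a b : SecHom X Y) :
  (forall e, a e = b e) -> a = b.
Proof.
case: a b => [a na] [b nb] /= H.
have Hab : a = b := functional_extensionality_dep a b H.
by clear H; subst b; f_equal; apply: proof_irrelevance.
Qed.

Lemma sec_idh_natural (X : SecOb) (e e' : E) (u : hom e e') :
  fmap (reind M u) (idc (X e')) ∘ sec_map X u = sec_map X u ∘ idc (X e).
Proof. by rewrite fmap_id comp_idl comp_idr. Qed.

Definition sec_idh (X : SecOb) : SecHom X X :=
  {| sec_hom := fun e => idc (X e); sec_hom_natural := @sec_idh_natural X |}.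

Lemma sec_comph_natural (X Y Z : SecOb) (b : SecHom Y Z) (a : SecHom X Y)
    (e e' : E) (u : hom e e') :
  fmap (reind M u) (b e' ∘ a e') ∘ sec_map X u = sec_map Z u ∘ (b e ∘ a e).
Proof.
rewrite fmap_comp -comp_assoc sec_hom_natural comp_assoc sec_hom_natural.
by rewrite comp_assoc.
Qed.

Definition sec_comph (X Y Z : SecOb) (b : SecHom Y Z) (a : SecHom X Y) :
    SecHom X Z :=
  {| sec_hom := fun e => b e ∘ a e;
     sec_hom_natural := @sec_comph_natural X Y Z b a |}.

Lemma sec_idl X Y (a : SecHom X Y) : sec_comph (sec_idh Y) a = a.
Proof. by apply: SecHom_eq => e /=; apply: comp_idl. Qed.

Lemma sec_idr X Y (a : SecHom X Y) : sec_comph a (sec_idh X) = a.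
Proof. by apply: SecHom_eq => e /=; apply: comp_idr. Qed.

Lemma sec_assoc W X Y Z (a : SecHom W X) (b : SecHom X Y) (c : SecHom Y Z) :
  sec_comph c (sec_comph b a) = sec_comph (sec_comph c b) a.
Proof. by apply: SecHom_eq => e /=; apply: comp_assoc. Qed.

Definition Sections : Category :=
  {| ob := SecOb; hom := SecHom; idc := sec_idh; comp := sec_comph;
     comp_idl := sec_idl; comp_idr := sec_idr; comp_assoc := sec_assoc |}.

End Sections.

Section Restriction.
Variables (E C : Category) (L : IndexedCat C) (J : Functor E C).

(** Structure 2-cells of [L ∘ J^op]: those of [L], corrected by the transports
    along [J id = id] and [J (v ∘ u) = J v ∘ J u]. *)
Definition restr_unitor_nt (e : E) (X : L (J e)) :
    hom X (reind L (fmap J (idc e)) X) :=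
  ctr (eq_sym (fmap_id J e)) X ∘ eta X.

Definition restr_compositor_nt (e e' e'' : E) (u : hom e e') (v : hom e' e'')
    (X : L (J e'')) :
    hom (reind L (fmap J u) (reind L (fmap J v) X))
      (reind L (fmap J (v ∘ u)) X) :=
  ctr (eq_sym (fmap_comp J u v)) X ∘ mu (fmap J u) (fmap J v) X.

Lemma restr_unitor_natural (e : E) (X Y : L (J e)) (m : hom X Y) :
  restr_unitor_nt Y ∘ m = fmap (reind L (fmap J (idc e))) m ∘ restr_unitor_nt X.
Proof.
by rewrite /restr_unitor_nt -comp_assoc eta_nat comp_assoc ctr_nat comp_assoc.
Qed.

Lemma restr_compositor_natural (e e' e'' : E) (u : hom e e') (v : hom e' e'')
    (X Y : L (J e'')) (m : hom X Y) :
  restr_compositor_nt u v Y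
    ∘ fmap (reind L (fmap J u)) (fmap (reind L (fmap J v)) m)
  = fmap (reind L (fmap J (v ∘ u))) m ∘ restr_compositor_nt u v X.
Proof.
rewrite /restr_compositor_nt -comp_assoc mu_nat comp_assoc ctr_nat.
by rewrite comp_assoc.
Qed.

Lemma cancel2 (D : Category) (x y z : D) (f : hom x y) (f' : hom y x)
    (g : hom y z) (g' : hom z y) :
  f' ∘ f = idc x -> g' ∘ g = idc y -> (f' ∘ g') ∘ (g ∘ f) = idc x.
Proof.
by move=> Hf Hg; rewrite -comp_assoc (reassoc Hg) comp_idl.
Qed.

Lemma ctrK (A B : C) (f g : hom A B) (p : f = g) (q : g = f) (Z : L B) :
  ctr q Z ∘ ctr p Z = idc _.
Proof. by rewrite ctr_trans ctr_id. Qed.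

Definition restr_unitor (e : E) :
    NatIso (Fid (L (J e))) (reind L (fmap J (idc e))) :=
  {| iso_nt := @Build_NatTrans _ _ (Fid (L (J e))) (reind L (fmap J (idc e)))
       (@restr_unitor_nt e) (@restr_unitor_natural e);
     iso_inv := fun X => eta_inv X ∘ ctr (fmap_id J e) X;
     iso_invl := fun X => cancel2 (eta_invK X) (ctrK _ _ X);
     iso_invr := fun X => cancel2 (ctrK _ _ X) (eta_Kinv X) |}.

Definition restr_compositor (e e' e'' : E) (u : hom e e') (v : hom e' e'') :
    NatIso (Fcomp (reind L (fmap J u)) (reind L (fmap J v)))
      (reind L (fmap J (v ∘ u))) :=
  {| iso_nt := @Build_NatTrans _ _
       (Fcomp (reind L (fmap J u)) (reind L (fmap J v)))
       (reind L (fmap J (v ∘ u)))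
       (@restr_compositor_nt e e' e'' u v)
       (@restr_compositor_natural e e' e'' u v);
     iso_inv := fun X =>
       mu_inv (fmap J u) (fmap J v) X ∘ ctr (fmap_comp J u v) X;
     iso_invl := fun X => cancel2 (mu_invK _ _ X) (ctrK _ _ X);
     iso_invr := fun X => cancel2 (ctrK _ _ X) (mu_Kinv _ _ X) |}.

Let rfib (e : E) : Category := L (J e).
Let rreind (e e' : E) (u : hom e e') : Functor (rfib e') (rfib e) :=
  reind L (fmap J u).

Lemma restr_transp (e e' : E) (u v : hom e e') (p : u = v) (Z : L (J e')) :
  @transp E rfib rreind e e' u v p Z = ctr (f_equal (@fmap E C J e e') p) Z.
Proof. by case: _ / p. Qed.

Lemma restr_unitor_l (e e' : E) (u : hom e e') (Z : rfib e') :
  restr_compositor (idc e) u Z ∘ restr_unitor e (rreind u Z)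
  = transp rreind (eq_sym (comp_idr u)) Z.
Proof.
rewrite restr_transp /= /restr_compositor_nt /restr_unitor_nt /rreind.
rewrite -!(@comp_assoc (L (J e))) (reassoc (mu_ctrl _ _ Z)).
rewrite -!(@comp_assoc (L (J e))) mu_etal !ctr_trans.
exact: ctr_irr.
Qed.

Lemma restr_unitor_r (e e' : E) (u : hom e e') (Z : rfib e') :
  restr_compositor u (idc e') Z ∘ fmap (rreind u) (restr_unitor e' Z)
  = transp rreind (eq_sym (comp_idl u)) Z.
Proof.
rewrite restr_transp /= /restr_compositor_nt /restr_unitor_nt /rreind (fmap_comp (reind L _)).
rewrite -!(@comp_assoc (L (J e))) (reassoc (mu_ctrr _ _ Z)).
rewrite -!(@comp_assoc (L (J e))) mu_etar !ctr_trans.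
exact: ctr_irr.
Qed.

Lemma restr_compositor_assoc (e1 e2 e3 e4 : E) (u : hom e1 e2) (v : hom e2 e3)
    (w : hom e3 e4) (Z : rfib e4) :
  restr_compositor u (w ∘ v) Z ∘ fmap (rreind u) (restr_compositor v w Z)
  = transp rreind (comp_assoc u v w) Z
    ∘ (restr_compositor (v ∘ u) w Z ∘ restr_compositor u v (rreind w Z)).
Proof.
rewrite restr_transp /= /restr_compositor_nt /rreind (fmap_comp (reind L _)).
rewrite -!(@comp_assoc (L (J e1))) (reassoc (mu_ctrr _ _ Z)).
rewrite (reassoc (mu_ctrl _ _ Z)).
rewrite -!(@comp_assoc (L (J e1))) mu_assoc.
do 4! rewrite ?(@comp_assoc (L (J e1))) ?ctr_trans.
by congr (_ ∘ _ ∘ _); apply: ctr_irr.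
Qed.

Definition restrict : IndexedCat E :=
  @Build_IndexedCat E rfib rreind restr_unitor restr_compositor
    restr_unitor_l restr_unitor_r restr_compositor_assoc.

End Restriction.

Section Comparison.
Variables (E C : Category) (L : IndexedCat C) (J : Functor E C) (c : Cocone J).

(** The inverse compositor has source [L(leg e' ∘ J u)(Z)]; the transport along
    the cocone equation makes it start at [L(leg e)(Z)]. *)
Definition cmp_map (Z : L (apex c)) (e e' : E) (u : hom e e') :
    hom (reind L (leg c e) Z) (reind L (fmap J u) (reind L (leg c e') Z)) :=
  iso_inv (compositor L (fmap J u) (leg c e')) Z
  ∘ ctr (eq_sym (leg_natural c u)) Z.

Lemma mu_cmp_map (Z : L (apex c)) (e e' : E) (u : hom e e') :
  mu (fmap J u) (leg c e') Z ∘ cmp_map Z u = ctr (eq_sym (leg_natural c u)) Z.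
Proof. by rewrite /cmp_map (reassoc (mu_Kinv _ _ Z)) comp_idl. Qed.

Lemma cmp_map_id (Z : L (apex c)) (e : E) :
  cmp_map Z (idc e) = restr_unitor_nt (reind L (leg c e) Z).
Proof.
apply: (@mu_mono _ _ _ _ _ (fmap J (idc e)) (leg c e) Z).
rewrite mu_cmp_map /restr_unitor_nt (reassoc (mu_ctrl _ _ Z)).
rewrite -!(@comp_assoc (L (J e))) mu_etal ctr_trans.
exact: ctr_irr.
Qed.

Lemma cmp_map_comp (Z : L (apex c)) (e e' e'' : E) (u : hom e e')
    (v : hom e' e'') :
  cmp_map Z (v ∘ u)
  = restr_compositor_nt u v (reind L (leg c e'') Z)
    ∘ (fmap (reind L (fmap J u)) (cmp_map Z v) ∘ cmp_map Z u).
Proof.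
apply: (@mu_mono _ _ _ _ _ (fmap J (v ∘ u)) (leg c e'') Z).
rewrite mu_cmp_map /restr_compositor_nt -!(@comp_assoc (L (J e))).
rewrite (reassoc (mu_ctrl _ _ Z)) -!(@comp_assoc (L (J e))).
rewrite (reassoc (mu_assoc_inv _ _ _ Z)) -!(@comp_assoc (L (J e))).
rewrite (comp_assoc (cmp_map Z u)) -(fmap_comp (reind L _)) mu_cmp_map.
rewrite (reassoc (mu_ctrr _ _ Z)) -!(@comp_assoc (L (J e))) mu_cmp_map.
rewrite !ctr_trans.
exact: ctr_irr.
Qed.

Definition cmp_ob (Z : L (apex c)) : Sections (restrict L J) :=
  @Build_SecOb E (restrict L J) (fun e => reind L (leg c e) Z)
    (cmp_map Z) (cmp_map_id Z) (@cmp_map_comp Z).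

Lemma cmp_hom_natural (Z W : L (apex c)) (m : hom Z W) (e e' : E)
    (u : hom e e') :
  fmap (reind L (fmap J u)) (fmap (reind L (leg c e')) m) ∘ cmp_map Z u
  = cmp_map W u ∘ fmap (reind L (leg c e)) m.
Proof.
apply: (@mu_mono _ _ _ _ _ (fmap J u) (leg c e') W).
rewrite (reassoc (mu_nat _ _ m)) (reassoc (mu_cmp_map W u)) ctr_nat.
by rewrite -!(@comp_assoc (L (J e))) mu_cmp_map.
Qed.

Definition cmp_hom (Z W : L (apex c)) (m : hom Z W) :
    hom (cmp_ob Z) (cmp_ob W) :=
  @Build_SecHom E (restrict L J) (cmp_ob Z) (cmp_ob W)
    (fun e => fmap (reind L (leg c e)) m) (@cmp_hom_natural Z W m).

Lemma cmp_id (Z : L (apex c)) : cmp_hom (idc Z) = idc (cmp_ob Z).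
Proof. by apply: SecHom_eq => e /=; apply: fmap_id. Qed.

Lemma cmp_comp (X Y Z : L (apex c)) (f : hom X Y) (g : hom Y Z) :
  cmp_hom (g ∘ f) = cmp_hom g ∘ cmp_hom f.
Proof. by apply: SecHom_eq => e /=; apply: fmap_comp. Qed.

Definition comparison : Functor (L (apex c)) (Sections (restrict L J)) :=
  @Build_Functor _ _ cmp_ob cmp_hom cmp_id cmp_comp.

End Comparison.

Definition extensive (E C : Category) (L : IndexedCat C) : Prop :=
  forall (J : Functor E C) (c : Cocone J),
    is_colimit c -> is_equivalence (comparison L c).

Definition left_Kan_extensive (E C : Category) (L : IndexedCat C) : Prop :=
  forall (J : Functor E C) (c : Cocone J),
    is_colimit c -> has_left_adjoint (comparison L c).

(* Main.v *)
From Stdlib Require Import ssreflect.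
Require Import Defs.

Set Implicit Arguments.
Unset Strict Implicit.
Unset Printing Implicit Defensive.

(** A diagram [J] in the Grothendieck construction is a diagram [J1] in [C]
    together with a section [X] of [L] along [J1]: the fibre components of the
    morphisms [J u] are the structure maps of [X], and functoriality of [J] is
    the pair of section axioms ([sec_of]). In the same way, a cocone under [J]
    lying over a cocone [c] of [J1] and with fibre [Z] at its apex is a morphism
    of sections from [X] to the image of [Z] under the comparison functor of
    [c] ([cocone_fib_natural]).

    Take for [c] a colimit of [J1], and let [X -> comparison Z] be a universal
    arrow from [X] to the comparison functor. The claim is that the
    corresponding cocone under [J] is a colimit ([is_colimit_groth_cocone]). For
    any other cocone [c'] under [J], the colimit in [C] provides a unique [h]
    between the apices in [C]. Restricting the fibre at the apex of [c'] along
    [h], which amounts to factoring the legs of [c'] through the cartesian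
    lift of [h], turns [c'] into a cocone over [c] itself, that is, into a
    morphism of sections out of [X]; the universal arrow factors this morphism
    uniquely, and the factorization is the fibre component of the mediating
    morphism.

    Universal arrows exist under either hypothesis: the unit of an adjunction
    provides them, and so do the inverse components of the isomorphism
    [R G = Id] of an equivalence, because an equivalence is fully faithful.
    Finally, the colimit obtained over [J] projects to the colimit [c]; colimits
    of [J] being unique up to isomorphism, the projection preserves them
    all. *)

(** * Universal arrows to a functor *)

Definition universal_arrow (A D : Category) (R : Functor A D) (d : D) (a : A)
    (u : hom d (R a)) : Prop :=
  forall (z : A) (g : hom d (R z)), exists! h : hom a z, fmap R h ∘ u = g.

Definition has_universal_arrows (A D : Category) (R : Functor A D) : Prop :=
  forall d : D, exists (a : A) (u : hom d (R a)), universal_arrow u.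

Lemma left_adjoint_universal_arrows (A D : Category) (R : Functor A D) :
  has_left_adjoint R -> has_universal_arrows R.
Proof.
case=> F [adj] d; exists (F d), (adj_unit adj d) => z g.
exists (adj_counit adj z ∘ fmap F g); split.
- have nat_g := nt_natural (adj_unit adj) g.
  cbn in nat_g; rewrite fmap_comp -comp_assoc -nat_g comp_assoc.
  by have /= -> := adj_triangler adj z; rewrite comp_idl.
- move=> h <-; rewrite fmap_comp comp_assoc.
  have nat_h := nt_natural (adj_counit adj) h.
  cbn in nat_h; rewrite nat_h -comp_assoc.
  by have /= -> := adj_trianglel adj d; rewrite comp_idr.
Qed.

Lemma iso_id_faithful (A : Category) (T : Functor A A) (i : NatIso (Fid A) T)
    (x y : A) (f g : hom x y) :
  fmap T f = fmap T g -> f = g.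
Proof.
move=> eq_T; rewrite -(comp_idl f) -(comp_idl g) -(iso_invl i y) -!comp_assoc.
by have /= -> := nt_natural i f; have /= -> := nt_natural i g; rewrite eq_T.
Qed.

Lemma natiso_sym (A D : Category) (F G : Functor A D) :
  NatIso F G -> NatIso G F.
Proof.
move=> i.
have nat_inv (x y : A) (f : hom x y) :
    iso_inv i y ∘ fmap G f = fmap F f ∘ iso_inv i x.
  rewrite -(comp_idr (_ ∘ fmap G f)) -(iso_invr i x) -comp_assoc.
  rewrite (comp_assoc _ _ (fmap G f)) -nt_natural -(comp_assoc (iso_inv i x)).
  by rewrite (reassoc (iso_invl i y)) comp_idl.
exact: (@Build_NatIso _ _ G F (@Build_NatTrans _ _ G F (iso_inv i) nat_inv) i
  (iso_invr i) (iso_invl i)).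
Qed.

(** Full faithfulness of [R] makes any isomorphism from [d] to some [R a] a
    universal arrow: a morphism [d -> R z] factors uniquely through it in the
    codomain, and the factor [R a -> R z] has a unique preimage under [R]. *)
Lemma equivalence_universal_arrows (A D : Category) (R : Functor A D) :
  is_equivalence R -> has_universal_arrows R.
Proof.
case=> G [[i] [j]] d.
have faithR (x y : A) (f g : hom x y) : fmap R f = fmap R g -> f = g.
  by move=> eq_R; apply: (iso_id_faithful i) => /=; rewrite eq_R.
have faithG (x y : D) (f g : hom x y) : fmap G f = fmap G g -> f = g.
  move=> eq_G; apply: (iso_id_faithful (natiso_sym j)) => /=.
  by rewrite eq_G.
have fullR (x y : A) (k : hom (R x) (R y)) : exists h, fmap R h = k.
  pose h : hom x y := iso_inv i y ∘ (fmap G k ∘ i x).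
  exists h; apply: faithG.
  (* As [i x] is invertible, it suffices to compare [G (R h)] with [G k] after
     precomposition with it, where naturality of [i] applies. *)
  rewrite -(comp_idr (fmap G _)) -(comp_idr (fmap G k)) -(iso_invr i x).
  rewrite !comp_assoc; congr (_ ∘ _).
  have /= <- := nt_natural i h.
  by rewrite (reassoc (iso_invr i y)) comp_idl.
exists (G d), (iso_inv j d) => z g.
have [h Rh] := fullR _ _ (g ∘ j d).
exists h; split.
  by rewrite Rh -comp_assoc; have /= -> := iso_invr j d; rewrite comp_idr.
move=> h' Rh'; apply: faithR.
by rewrite Rh -Rh' -comp_assoc; have /= -> := iso_invl j d; rewrite comp_idr.
Qed.

(** * Cartesian lifts in the Grothendieck construction *)

Section Cartesian.
Variables (C : Category) (L : IndexedCat C).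

Lemma hfib_eq (X Y : GrothOb L) (u v : GrothHom X Y) (H : u = v) :
  ctr (f_equal (@hbase _ _ X Y) H) (gfib Y) ∘ hfib u = hfib v.
Proof. by destruct H; rewrite ctr_id comp_idl. Qed.

Lemma hfib_inj (X Y : GrothOb L) (f : hom (gbase X) (gbase Y))
    (a b : hom (gfib X) (reind L f (gfib Y))) :
  Build_GrothHom a = Build_GrothHom b -> a = b.
Proof. by move=> H; rewrite -[b](hfib_eq H) ctr_id comp_idl. Qed.

Definition reindex (B : C) (Y : GrothOb L) (h : hom B (gbase Y)) : GrothOb L :=
  {| gbase := B; gfib := reind L h (gfib Y) |}.

Definition cart (B : C) (Y : GrothOb L) (h : hom B (gbase Y)) :
    GrothHom (reindex h) Y :=
  @Build_GrothHom C L (reindex h) Y h (idc _).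

Lemma hfib_cart_comp (X Y : GrothOb L) (B : C) (h : hom B (gbase Y))
    (v : GrothHom X (reindex h)) :
  hfib (groth_comp (cart h) v) = mu (hbase v) h (gfib Y) ∘ hfib v.
Proof. by rewrite /= fmap_id comp_idl. Qed.

Definition cart_lift (X Y : GrothOb L) (B : C) (h : hom B (gbase Y))
    (k : GrothHom X Y) (f : hom (gbase X) B) (p : h ∘ f = hbase k) :
    GrothHom X (reindex h) :=
  @Build_GrothHom C L X (reindex h) f
    (mu_inv f h (gfib Y) ∘ (ctr (eq_sym p) (gfib Y) ∘ hfib k)).

Lemma cart_liftK (X Y : GrothOb L) (B : C) (h : hom B (gbase Y))
    (k : GrothHom X Y) (f : hom (gbase X) B) (p : h ∘ f = hbase k) :
  groth_comp (cart h) (cart_lift p) = k.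
Proof.
apply: (@GrothHom_eq _ _ _ _ (groth_comp (cart h) (cart_lift p)) k p).
rewrite hfib_cart_comp /=.
by rewrite (reassoc (mu_Kinv _ _ _)) comp_idl (reassoc (ctrK _ _ _)) comp_idl.
Qed.

(** Over a fixed base morphism, composing with a cartesian morphism only
    composes the fibre component with a compositor, which is invertible. *)
Lemma cart_mono (X Y : GrothOb L) (B : C) (h : hom B (gbase Y))
    (u v : GrothHom X (reindex h)) :
  hbase u = hbase v -> groth_comp (cart h) u = groth_comp (cart h) v -> u = v.
Proof.
case: u v => [f a] [g b] /= eq_fg; subst g => eq_comp.
have := hfib_eq eq_comp.
rewrite ctr_id comp_idl !hfib_cart_comp /= => eq_mu.
by rewrite (mu_mono eq_mu).
Qed.

(** Every morphism is a vertical one followed by a cartesian one; here the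
    vertical part is absorbed into the morphism composed on the right. *)
Lemma groth_comp_cart (X Y Z : GrothOb L) (k : GrothHom Y Z)
    (v : GrothHom X Y) :
  groth_comp k v
  = groth_comp (cart (hbase k))
      (@Build_GrothHom C L X (reindex (hbase k)) (hbase v)
        (fmap (reind L (hbase v)) (hfib k) ∘ hfib v)).
Proof.
by rewrite /groth_comp /= fmap_id comp_idl.
Qed.

End Cartesian.

(** * Diagrams and cocones as sections and their morphisms *)

Section Diagram.
Variables (E C : Category) (L : IndexedCat C) (J : Functor E (Groth L)).

Let J1 : Functor E C := Fcomp (groth_proj L) J.

Definition diag_fib (e : E) : restrict L J1 e := gfib (J e).

Definition diag_map (e e' : E) (u : hom e e') :
    hom (diag_fib e) (reind (restrict L J1) u (diag_fib e')) :=
  hfib (fmap J u).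

Lemma diag_map_id (e : E) :
  diag_map (idc e) = unitor (restrict L J1) e (diag_fib e).
Proof.
rewrite /diag_map -(hfib_eq (eq_sym (fmap_id J e))).
by congr (_ ∘ _); apply: ctr_irr.
Qed.

Lemma diag_map_comp (e e' e'' : E) (u : hom e e') (v : hom e' e'') :
  diag_map (v ∘ u)
  = compositor (restrict L J1) u v (diag_fib e'')
    ∘ (fmap (reind (restrict L J1) u) (diag_map v) ∘ diag_map u).
Proof.
rewrite /diag_map -(hfib_eq (eq_sym (fmap_comp J u v))) /= /restr_compositor_nt.
rewrite -!(@comp_assoc (L (gbase (J e)))).
by congr (_ ∘ _); apply: ctr_irr.
Qed.

Definition sec_of : Sections (restrict L J1) :=
  Build_SecOb diag_map_id diag_map_comp.

Section Fibre.
Variables (c : Cocone J1) (Z : L (apex c)).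

Definition leg_over (e : E) (a : hom (diag_fib e) (reind L (leg c e) Z)) :
    hom (J e) (Build_GrothOb Z : Groth L) :=
  @Build_GrothHom C L (J e) (Build_GrothOb Z) (leg c e) a.

(** Transposing the inverse compositor hidden in [cmp_map] to the other side
    turns the naturality square of a morphism of sections into the fibre
    component of the cocone equation. *)
Lemma cocone_fib_natural (e e' : E) (u : hom e e')
    (a : hom (diag_fib e) (reind L (leg c e) Z))
    (a' : hom (diag_fib e') (reind L (leg c e') Z)) :
  leg_over a' ∘ fmap J u = leg_over a <->
  fmap (reind L (fmap J1 u)) a' ∘ diag_map u = cmp_map Z u ∘ a.
Proof.
split=> [eq_leg | eq_sec].
- apply: (@mu_mono _ L _ _ _ (fmap J1 u) (leg c e') Z).
  rewrite (reassoc (mu_cmp_map Z u)).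
  rewrite -[LHS](hfib_eq (eq_sym eq_leg)) /=.
  by congr (_ ∘ _); apply: ctr_irr.
- apply: (@GrothHom_eq _ _ _ _ (leg_over a' ∘ fmap J u) (leg_over a)
    (leg_natural c u)).
  rewrite -[LHS]/(ctr (leg_natural c u) Z ∘ (mu (fmap J1 u) (leg c e') Z
    ∘ (fmap (reind L (fmap J1 u)) a' ∘ diag_map u))).
  by rewrite eq_sec (reassoc (mu_cmp_map Z u)) (reassoc (ctrK _ _ Z)) comp_idl.
Qed.

Definition groth_cocone (a : hom sec_of (comparison L c Z)) : Cocone J :=
  @Build_Cocone E (Groth L) J (Build_GrothOb Z) (fun e => leg_over (a e))
    (fun e e' u =>
      proj2 (cocone_fib_natural u (a e) (a e')) (sec_hom_natural a u)).

End Fibre.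

Section Lift.
Variables (c : Cocone J1) (c' : Cocone J).
Variables (h : hom (apex c) (gbase (apex c'))).
Hypothesis (Hh : forall e, h ∘ leg c e = hbase (leg c' e)).

Let a (e : E) := hfib (cart_lift (Hh e)).

(** The lifted legs form a cocone because their composites with the cartesian
    lift of [h] do: both sides of each cocone equation lie over [leg c e], where
    the cartesian lift can be cancelled. *)
Lemma lift_natural (e e' : E) (u : hom e e') :
  fmap (reind L (fmap J1 u)) (a e') ∘ diag_map u
  = cmp_map (reind L h (gfib (apex c'))) u ∘ a e.
Proof.
apply (proj1 (cocone_fib_natural u (a e) (a e'))).
apply (@cart_mono C L (J e) (apex c') (apex c) h).
  exact: (leg_natural c u).
transitivity (leg c' e); last by symmetry; exact (cart_liftK (Hh e)).
rewrite -(leg_natural c' u).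
transitivity (groth_comp (groth_comp (cart h) (cart_lift (Hh e'))) (fmap J u)).
  exact: groth_assoc.
by rewrite cart_liftK.
Qed.

Definition lift_sec :
    hom sec_of (comparison L c (reind L h (gfib (apex c')))) :=
  @Build_SecHom E (restrict L J1) sec_of
    (comparison L c (reind L h (gfib (apex c')))) a lift_natural.

(** After [groth_comp_cart], the composite with the leg at [e] and the leg
    [c' e] are both the cartesian lift of [h] after a morphism over [leg c e];
    by [cart_mono] they agree exactly when the fibre components of these two
    morphisms do, and these are the components at [e] of the two morphisms of
    sections. *)
Lemma mediating_sec (Z : L (apex c)) (w : hom sec_of (comparison L c Z))
    (m : hom Z (reind L h (gfib (apex c')))) :
  fmap (comparison L c) m ∘ w = lift_sec <->
  forall e, (@Build_GrothHom C L (Build_GrothOb Z) (apex c') h m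
             : hom (apex (groth_cocone w)) (apex c'))
            ∘ leg (groth_cocone w) e = leg c' e.
Proof.
split=> [eq_m e | eq_leg].
- rewrite [LHS]groth_comp_cart -[RHS](cart_liftK (Hh e)).
  congr groth_comp; congr Build_GrothHom.
  exact: (f_equal (fun b : SecHom _ _ => b e) eq_m).
- apply: SecHom_eq => e; apply: (@hfib_inj C L (J e) (reindex h) (leg c e)).
  apply: cart_mono => //.
  have := eq_leg e; rewrite [X in X = _ -> _]groth_comp_cart => ->.
  by rewrite -[LHS](cart_liftK (Hh e)).
Qed.

End Lift.

Lemma is_colimit_groth_cocone (c : Cocone J1) (Hc : is_colimit c)
    (Z : L (apex c)) (w : hom sec_of (comparison L c Z)) :
  universal_arrow w -> is_colimit (groth_cocone w).
Proof.
move=> univ c'.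
have [h [Hh uniq_h]] := Hc (map_cocone (groth_proj L) c').
have [m [Hm uniq_m]] := univ _ (lift_sec Hh).
exists (@Build_GrothHom C L (Build_GrothOb Z) (apex c') h m).
split; first exact/(mediating_sec Hh).
case=> h' m' /= Hk.
have eq_h : h = h'.
  by apply: uniq_h => e; exact: (f_equal (@hbase _ _ _ _) (Hk e)).
subst h'; congr Build_GrothHom.
exact/uniq_m/(mediating_sec Hh).
Qed.

End Diagram.

(** * Preservation of colimits *)

(** A colimit cocone stays one when it is carried along an isomorphism, and any
    two colimits are isomorphic. *)
Lemma preserves_colimit_of_one (E A B : Category) (P : Functor A B)
    (J : Functor E A) (c0 c : Cocone J) :
  is_colimit c0 -> is_colimit (map_cocone P c0) -> is_colimit c ->
  is_colimit (map_cocone P c).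
Proof.
move=> Hc0 HPc0 Hc c'.
have [i [Hi _]] := Hc0 c; have [j [Hj _]] := Hc c0.
have ij : i ∘ j = idc _.
  have [k [_ uniq_k]] := Hc c.
  have <- : k = i ∘ j by apply: uniq_k => e; rewrite -comp_assoc Hj Hi.
  by apply: uniq_k => e; exact: comp_idl.
have [h [Hh uniq_h]] := HPc0 c'.
exists (h ∘ fmap P j); split=> [e | h' Hh'] /=.
  by rewrite -comp_assoc -fmap_comp Hj; exact: Hh.
have -> : h = h' ∘ fmap P i.
  apply: uniq_h => e /=; rewrite -comp_assoc -fmap_comp Hi; exact: Hh'.
by rewrite -comp_assoc -fmap_comp ij fmap_id comp_idr.
Qed.

(** * Colimits in the Grothendieck construction *)

Theorem corollary6p6 (E C : Category) (HC : has_colimits E C)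
    (L : IndexedCat C)
    (HL : extensive E L \/ left_Kan_extensive E L) :
  has_colimits E (Groth L) /\ preserves_colimits E (groth_proj L).
Proof.
have univ (J : Functor E C) (c : Cocone J) :
    is_colimit c -> has_universal_arrows (comparison L c).
  case: HL => HL Hc; first exact/equivalence_universal_arrows/HL.
  exact/left_adjoint_universal_arrows/HL.
have colim (J : Functor E (Groth L)) : exists c0 : Cocone J,
    is_colimit c0 /\ is_colimit (map_cocone (groth_proj L) c0).
  have [c Hc] := HC (Fcomp (groth_proj L) J).
  have [Z [w univ_w]] := univ _ c Hc (sec_of J).
  exists (groth_cocone w); split; first exact: is_colimit_groth_cocone.
  (* The projected cocone has the same apex and legs as [c]. *)
  move=> c'; exact: Hc c'.
split=> [J | J c]; have [c0 [Hc0 HPc0]] := colim J; first by exists c0.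
exact: preserves_colimit_of_one HPc0.
Qed.
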